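(* For every $n\ge 3$, every pyramid over an $n$-gon is coherently labellable.
   Context: A pyramid over an $n$-gon is the convex polyhedron obtained by joining every vertex of a convex $n$-gon (the base) to a point (the apex) outside the plane of the base; its faces are the base and $n$ triangles. For a convex polyhedron, each face $F$ is oriented by the outward normal, so its boundary edges are traversed anticlockwise as seen from outside. A labelling of all the edges by integers is coherent if, for each face $F$ with $n_F$ edges, there is a choice of starting edge such that the successive labels read anticlockwise from that edge satisfy $a_1<a_2<\cdots<a_{n_F}$. The polyhedron is coherently labellable if it has a coherent labelling. *)

(* Defs.v *)
From HB Require Import structures.
From mathcomp Require Import all_boot all_order all_algebra.
From mathcomp Require Import all_classical all_reals convex.

Set Implicit Arguments.
Unset Strict Implicit.
Unset Printing Implicit Defensive.

Import Order.TTheory GRing.Theory Num.Theory.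

Local Open Scope classical_set_scope.
Local Open Scope ring_scope.

Definition hull (R : realType) (A : set 'rV[R]_3) : set 'rV[R]_3 :=
  smallest (@convex_set R 'rV[R]_3) A.

Definition segment (R : realType) (p q : 'rV[R]_3) : set 'rV[R]_3 :=
  hull [set p; q].

Definition dot (R : realType) (u v : 'rV[R]_3) : R :=
  \sum_i u 0 i * v 0 i.

(* The triple product u . (v x w). *)
Definition triple (R : realType) (u v w : 'rV[R]_3) : R :=
  \det (\matrix_(i < 3) [:: u; v; w]`_i).

Definition collinear (R : realType) (A : set 'rV[R]_3) : Prop :=
  exists p d : 'rV[R]_3, forall x, A x -> exists t : R, x = p + t *: d.

Definition coplanar (R : realType) (A : set 'rV[R]_3) : Prop :=
  exists (u : 'rV[R]_3) (c : R), u != 0 /\ forall x, A x -> dot u x = c.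

Definition convex_polyhedron (R : realType) (P : set 'rV[R]_3) : Prop :=
  ~ coplanar P /\ exists V : set 'rV[R]_3, finite_set V /\ P = hull V.

(* The face of P cut out by its supporting plane with outward normal u
   (a vertex, an edge or a two-dimensional face). *)
Definition face (R : realType) (P : set 'rV[R]_3) (u : 'rV[R]_3) :
    set 'rV[R]_3 :=
  [set x | P x /\ forall y, P y -> dot u y <= dot u x].

(* u is an outward normal of a two-dimensional face of P. *)
Definition facet_normal (R : realType) (P : set 'rV[R]_3) (u : 'rV[R]_3) :
    Prop :=
  u != 0 /\ ~ collinear (face P u).

Definition edge (R : realType) (P E : set 'rV[R]_3) : Prop :=
  exists u p q : 'rV[R]_3,
    [/\ u != 0, p != q, E = segment p q & E = face P u].

(* The edge pq of the face with outward normal u, traversed from p to q,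
   is traversed anticlockwise as seen from outside: the face lies to its
   left for a viewer towards whom u points. *)
Definition anticlockwise_edge (R : realType) (P : set 'rV[R]_3)
    (u p q : 'rV[R]_3) : Prop :=
  [/\ p != q, edge P (segment p q), segment p q `<=` face P u &
      forall x, face P u x -> 0 <= triple u (q - p) (x - p)].

(* s lists the successive vertices met when going once anticlockwise around
   the face with outward normal u; the head of s is the start of the
   starting edge, and the last edge of the tour returns to it. *)
Definition anticlockwise_tour (R : realType) (P : set 'rV[R]_3)
    (u : 'rV[R]_3) (s : seq 'rV[R]_3) : Prop :=
  [/\ uniq s,
      forall p, p \in s -> anticlockwise_edge P u p (next s p) &
      forall E, edge P E -> E `<=` face P u ->
        exists2 p, p \in s & E = segment p (next s p)].

(* Only the values of a labelling on the edges of P matter. *)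
Definition coherent (R : realType) (P : set 'rV[R]_3)
    (lab : set 'rV[R]_3 -> int) : Prop :=
  forall u, facet_normal P u ->
  exists2 s, anticlockwise_tour P u s &
             sorted <%R [seq lab (segment p (next s p)) | p <- s].

Definition coherently_labellable (R : realType) (P : set 'rV[R]_3) : Prop :=
  convex_polyhedron P /\ exists lab : set 'rV[R]_3 -> int, coherent P lab.

(* A convex n-gon is the hull of n coplanar points in convex position;
   for 3 <= n, convex position forces these points not to be collinear. *)
Definition convex_ngon (R : realType) (n : nat) (B : set 'rV[R]_3) : Prop :=
  exists v : 'I_n -> 'rV[R]_3,
    [/\ coplanar (range v),
        forall i, ~ hull (v @` [set j | j != i]) (v i) &
        B = hull (range v)].

Definition pyramid (R : realType) (n : nat) (P : set 'rV[R]_3) : Prop :=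
  exists (B : set 'rV[R]_3) (apex : 'rV[R]_3),
    [/\ convex_ngon n B, ~ coplanar (apex |` B) & P = hull (apex |` B)].

(* Main.v *)
Require Import Defs.
From mathcomp Require Import all_boot all_order all_algebra.
From mathcomp Require Import all_classical all_reals.
From mathcomp Require Import interval_inference convex ring lra.

Import Order.TTheory GRing.Theory Num.Theory.

(** Let [a] be the apex and let [b_0, ..., b_(n-1)] be the vertices of the base
    in the order in which they are met anticlockwise around the base as seen
    from outside.  Label the base edge [b_i b_(i+1)] by [2i] and the lateral
    edge [a b_i] by [2i + 1].  Around the base the labels read
    [0 < 2 < ... < 2(n-1)].  The triangle on [b_i b_(i+1)] is traversed as
    [b_(i+1), b_i, a]; its labels read [2i < 2i + 1 < 2i + 3] when [i < n - 1],
    and for [i = n - 1], starting at the apex, [1 < 2(n-1) < 2(n-1) + 1].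

    The rest of the proof derives this combinatorial picture from the metric
    definitions.  Everything is expressed by the sign of [turn a p q r], the
    determinant of [p - a], [q - a], [r - a], which is the orientation of the
    triangle [p q r] of the base seen through the apex.  Cramer's rule makes
    the determinants the barycentric coordinates of a fourth base vertex, so
    that convex position forbids certain sign patterns ([notin_triangle]);
    sorting the vertices by angle around one of them then gives the cyclic
    order ([convex_cycle_exists]).  A face of a hull is the hull of the
    generators that maximise the normal functional ([face_hull]), so faces are
    determined by evaluating functionals at [a] and at the [b_i].  This yields
    all the edges ([edge_lateral], [edge_base], [edgeP]), all the facets
    ([facet_normalP]) and their anticlockwise tours ([tour_base],
    [tour_side]). *)

Section Pyramids.

Set Implicit Arguments.
Unset Strict Implicit.
Unset Printing Implicit Defensive.

Local Open Scope classical_set_scope.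
Local Open Scope ring_scope.

Variable R : realType.
Local Notation vec := 'rV[R]_3.
Implicit Types (u v w x y z p q r a : 'rV[R]_3) (A V : set 'rV[R]_3).

(** * Vector algebra in three dimensions *)

Lemma vec3P u v : u 0 0 = v 0 0 -> u 0 1 = v 0 1 -> u 0 2 = v 0 2 -> u = v.
Proof.
move=> e0 e1 e2; apply/rowP => i.
have [->|->|->] : [\/ i = 0, i = 1 | i = 2]; [|exact: e0|exact: e1|exact: e2].
case: i => -[|[|[|//]]] lti; [exact: Or31 (val_inj _)|exact: Or32 (val_inj _)|].
exact: Or33 (val_inj _).
Qed.

Lemma dotE u v : dot u v = u 0 0 * v 0 0 + u 0 1 * v 0 1 + u 0 2 * v 0 2.
Proof.
rewrite /dot !big_ord_recl big_ord0 addr0 addrA.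
by congr (_ + _ * _ + _ * _); congr (_ 0 _); apply: val_inj.
Qed.

Lemma tripleE u v w : triple u v w =
    u 0 0 * (v 0 1 * w 0 2 - v 0 2 * w 0 1)
  + u 0 1 * (v 0 2 * w 0 0 - v 0 0 * w 0 2)
  + u 0 2 * (v 0 0 * w 0 1 - v 0 1 * w 0 0).
Proof.
rewrite /triple (expand_det_row _ 0) !big_ord_recl big_ord0 addr0 /cofactor.
rewrite !(expand_det_row _ (0 : 'I_2)) !big_ord_recl !big_ord0 /cofactor !det_mx11.
rewrite !mxE /=.
have [c cE] : exists c : vec -> nat -> R, forall x i, x 0 i = c x (val i).
  by exists (fun x k => x 0 (inord k)) => x i; rewrite inord_val.
rewrite !cE /= /bump /=; ring.
Qed.

(** The cross product. *)
Definition cross u v : vec := \row_(i < 3) [:: u 0 1 * v 0 2 - u 0 2 * v 0 1;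
  u 0 2 * v 0 0 - u 0 0 * v 0 2; u 0 0 * v 0 1 - u 0 1 * v 0 0]`_i.

Lemma cross0E u v : cross u v 0 0 = u 0 1 * v 0 2 - u 0 2 * v 0 1.
Proof. by rewrite mxE. Qed.

Lemma cross1E u v : cross u v 0 1 = u 0 2 * v 0 0 - u 0 0 * v 0 2.
Proof. by rewrite mxE. Qed.

Lemma cross2E u v : cross u v 0 2 = u 0 0 * v 0 1 - u 0 1 * v 0 0.
Proof. by rewrite mxE. Qed.

(** Proves a polynomial identity between vectors by expanding coordinates.
    The rules for [cross] come before [mxE], which would unfold it. *)
Ltac coordinates :=
  rewrite ?tripleE ?dotE ?(cross0E, cross1E, cross2E) ?mxE
    ?(cross0E, cross1E, cross2E) ?mxE; ring.

Lemma dot_crossl u v w : dot (cross u v) w = triple u v w.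
Proof. coordinates. Qed.

Lemma dotC u v : dot u v = dot v u.
Proof. coordinates. Qed.

Lemma dotDr u v w : dot u (v + w) = dot u v + dot u w.
Proof. coordinates. Qed.

Lemma dotBr u v w : dot u (v - w) = dot u v - dot u w.
Proof. coordinates. Qed.

Lemma dotZr u t v : dot u (t *: v) = t * dot u v.
Proof. coordinates. Qed.

Lemma dotDl u v w : dot (u + v) w = dot u w + dot v w.
Proof. coordinates. Qed.

Lemma dotZl u t v : dot (t *: u) v = t * dot u v.
Proof. coordinates. Qed.

Lemma dotNl u v : dot (- u) v = - dot u v.
Proof. coordinates. Qed.

Lemma dot0l v : dot 0 v = 0.
Proof. coordinates. Qed.

Lemma dot0r u : dot u 0 = 0.
Proof. by rewrite dotC dot0l. Qed.

Lemma dotBl u v w : dot (u - v) w = dot u w - dot v w.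
Proof. by rewrite dotDl dotNl. Qed.

Lemma dotvv_ge0 u : 0 <= dot u u.
Proof. by rewrite sumr_ge0 // => i _; rewrite -expr2 sqr_ge0. Qed.

Lemma dotvv_eq0 u : (dot u u == 0) = (u == 0).
Proof.
apply/eqP/eqP => [|->]; last exact: dot0l.
move/eqP; rewrite /dot psumr_eq0 => [/allP u0|i _]; last first.
  by rewrite -expr2 sqr_ge0.
apply/rowP => i; rewrite mxE; apply/eqP.
by have := u0 i (mem_index_enum _); rewrite -expr2 sqrf_eq0.
Qed.

Lemma dotvv_gt0 u : u != 0 -> 0 < dot u u.
Proof. by move=> u0; rewrite lt_neqAle dotvv_ge0 eq_sym dotvv_eq0 u0. Qed.

(** Cramer's rule, evaluated under the functional [dot u]. *)
Lemma cramer u p q r x :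
  triple p q r * dot u x = triple x q r * dot u p + triple p x r * dot u q
                         + triple p q x * dot u r.
Proof. coordinates. Qed.

Lemma cramer_vec p q r x :
  triple p q r *: x = triple x q r *: p + triple p x r *: q + triple p q x *: r.
Proof. by apply: vec3P; coordinates. Qed.

Lemma eq0_of_triple_neq0 g p q r : triple p q r != 0 ->
  dot g p = 0 -> dot g q = 0 -> dot g r = 0 -> g = 0.
Proof.
move=> t0 gp gq gr; apply/eqP; rewrite -dotvv_eq0.
have := cramer g p q r g; rewrite gp gq gr !mulr0 !addr0 => /eqP.
by rewrite mulf_eq0 (negbTE t0).
Qed.

Lemma cross0l v : cross 0 v = 0.
Proof. by apply: vec3P; coordinates. Qed.

Lemma cross_crossl u v w : cross (cross u v) w = dot u w *: v - dot v w *: u.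
Proof. by apply: vec3P; coordinates. Qed.

Lemma triple_rot u v w : triple v w u = triple u v w.
Proof. coordinates. Qed.

Lemma triple_swap u v w : triple v u w = - triple u v w.
Proof. coordinates. Qed.

(** * Convex hulls and their faces *)

Lemma convex_setP A : convex_set A <->
  (forall x y t, 0 <= t <= 1 -> A x -> A y -> A (t *: x + (1 - t) *: y)).
Proof.
split=> [cA x y t t01 Ax Ay | cA x y l].
  have /andP[t0 t1] := t01.
  by have := cA x y (Itv01 t0 t1); rewrite !inE; apply.
rewrite !inE; apply: cA; apply/andP; split; [exact: ge0|exact: le1].
Qed.

Lemma convex_hull A : convex_set (hull A).
Proof.
by apply/convex_setP => x y t t01 Ax Ay B [cB AB];
  move/convex_setP: (cB); apply=> //; [exact: Ax|exact: Ay].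
Qed.

Lemma sub_hull A : A `<=` hull A.
Proof. exact: sub_gen_smallest. Qed.

Lemma hull_sub A B : convex_set B -> A `<=` B -> hull A `<=` B.
Proof. exact: smallest_sub. Qed.

Lemma hullS A B : A `<=` B -> hull A `<=` hull B.
Proof.
move=> AB; apply: hull_sub; first exact: convex_hull.
exact: subset_trans (@sub_hull B).
Qed.

Lemma hullU1 a A : hull (a |` hull A) = hull (a |` A).
Proof.
apply/seteqP; split; last first.
  by apply: hullS => x [->|Ax]; [left|right; apply: sub_hull].
apply: hull_sub => [|x [->|]]; [exact: convex_hull| |]; first by apply: sub_hull; left.
by apply: hullS => y; right.
Qed.

Lemma segmentC p q : segment p q = segment q p.
Proof. by rewrite /segment setUC. Qed.

Lemma convex_halfspace u c : convex_set [set x | dot u x <= c].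
Proof.
apply/convex_setP => x y t /andP[t0 t1] /= xc yc; rewrite dotDr !dotZr; nra.
Qed.

Lemma convex_line p d : convex_set [set x | exists t : R, x = p + t *: d].
Proof.
apply/convex_setP => x y t t01 [s ->] [s' ->] /=.
exists (t * s + (1 - t) * s'); apply/rowP => i; rewrite !mxE; ring.
Qed.

(** The face of a hull is the hull of the generators at which the functional
    attains its maximum. *)
Lemma face_hull V u m : (forall x, V x -> dot u x <= m) ->
  (exists2 x, V x & dot u x = m) ->
  face (hull V) u = hull [set x | V x /\ dot u x = m].
Proof.
move=> Vm [x0 Vx0 x0m].
have hVm : hull V `<=` [set x | dot u x <= m].
  by apply: hull_sub => [|y]; [exact: convex_halfspace|apply: Vm].
set F := [set x | _].
have hFm x : hull F x -> dot u x = m.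
  move=> Fx; apply/eqP; rewrite eq_le hVm /=; last by apply: hullS Fx => y [].
  rewrite -lerN2 -dotNl.
  suff : hull F `<=` [set x | dot (- u) x <= - m] by apply.
  apply: hull_sub => [|y [_ <-] /=]; first exact: convex_halfspace.
  by rewrite dotNl.
apply/seteqP; split=> x; last first.
  move=> Fx; split; first by apply: hullS Fx => y [].
  by move=> y /hVm; rewrite (hFm x Fx).
case=> Vx xmax.
suff : [set x | dot u x < m \/ hull F x] x.
  by case=> // xm; have := xmax x0 (sub_hull Vx0); rewrite x0m leNgt xm.
(* This set is convex: a proper convex combination with a point below the
   level m stays below it. *)
suff sub : hull V `<=` [set x | dot u x < m \/ hull F x] by exact: sub.
apply: hull_sub; last first.
  move=> y Vy /=; have := Vm y Vy; rewrite le_eqVlt => /predU1P[ym|]; last by left.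
  by right; apply: sub_hull.
apply/convex_setP => {x xmax Vx} x y t t01 /= Hx Hy.
have [t0|t0] := eqVneq t 0; first by rewrite t0 scale0r subr0 scale1r add0r.
have [t1|t1] := eqVneq t 1; first by rewrite t1 scale1r subrr scale0r addr0.
have {t01} [t_gt0 t_lt1] : 0 < t /\ t < 1.
  by case/andP: t01; rewrite !le_eqVlt eq_sym (negbTE t0) (negbTE t1).
have [Fx|nFx] := pselect (hull F x); have [Fy|nFy] := pselect (hull F y).
- right; move/convex_setP: (@convex_hull F); apply=> //.
  by rewrite (ltW t_gt0) (ltW t_lt1).
- left; case: Hy => // ym; rewrite dotDr !dotZr (hFm _ Fx); nra.
- left; case: Hx => // xm; rewrite dotDr !dotZr (hFm _ Fy); nra.
- left; case: Hx => // xm; case: Hy => // ym; rewrite dotDr !dotZr; nra.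
Qed.

(** Membership in a triangle by homogeneous barycentric coordinates. *)
Lemma hull3 p q r x (s t o : R) : 0 <= s -> 0 <= t -> 0 <= o ->
  0 < s + t + o -> (s + t + o) *: x = s *: p + t *: q + o *: r ->
  hull [set p; q; r] x.
Proof.
move=> s0 t0 o0 sto xE; set H := hull _.
have Hp : H p by apply: sub_hull; left; left.
have Hq : H q by apply: sub_hull; left; right.
have Hr : H r by apply: sub_hull; right.
have cH := (convex_setP H).1 (@convex_hull _).
have sto0 : s + t + o != 0 by rewrite gt_eqF.
have [st0|st0] := eqVneq (s + t) 0.
  have [s00 t00] : s = 0 /\ t = 0 by lra.
  move: xE sto0; rewrite s00 t00 !scale0r !add0r => xE oN0.
  by rewrite (scalerI oN0 xE).
have st_gt0 : 0 < s + t by rewrite lt_neqAle eq_sym st0 addr_ge0.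
have -> : x = ((s + t) / (s + t + o)) *: ((s / (s + t)) *: p + (1 - s / (s + t)) *: q)
    + (1 - (s + t) / (s + t + o)) *: r.
  apply: (scalerI sto0); rewrite xE; apply/rowP => i; rewrite !mxE; field.
  by rewrite sto0.
apply: (cH) => //; last apply: (cH) => //.
- by rewrite divr_ge0 ?ler_pdivrMr ?(ltW sto) ?(ltW st_gt0) //= mul1r; lra.
- by rewrite divr_ge0 ?ler_pdivrMr ?(ltW sto) ?(ltW st_gt0) //= mul1r; lra.
Qed.

(** * Finite sequences *)

Lemma seq_max (f : vec -> R) x0 (s : seq vec) :
  exists2 x, x \in x0 :: s & forall y, y \in x0 :: s -> f y <= f x.
Proof.
elim: s x0 => [|x1 s IH] x0.
  by exists x0; rewrite ?mem_head // => y; rewrite inE => /eqP ->.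
have [x xs xmax] := IH x1.
have [le|lt] := leP (f x0) (f x).
  by exists x => [|y]; rewrite inE ?xs ?orbT // => /predU1P[->|/xmax].
exists x0 => [|y]; first exact: mem_head.
by rewrite inE => /predU1P[->|/xmax yx]; rewrite // (le_trans yx) ?ltW.
Qed.

Lemma next3 (T : eqType) (x1 x2 x3 : T) : x1 != x2 -> x3 != x1 -> x3 != x2 ->
  [/\ next [:: x1; x2; x3] x1 = x2, next [:: x1; x2; x3] x2 = x3 &
      next [:: x1; x2; x3] x3 = x1].
Proof.
move=> x12 x31 x32.
by rewrite /= !eqxx (negbTE x31) (negbTE x32) (eq_sym x2) (negbTE x12).
Qed.

(** * The cyclic order of points in convex position *)

(** The orientation of the triangle [p q r] seen through the point [a]. *)
Definition turn a p q r : R := triple (p - a) (q - a) (r - a).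

Lemma turn_rot a p q r : turn a q r p = turn a p q r.
Proof. exact: triple_rot. Qed.

Lemma turn_swap a p q r : turn a q p r = - turn a p q r.
Proof. exact: triple_swap. Qed.

Lemma turn_swapr a p q r : turn a p r q = - turn a p q r.
Proof. by rewrite -turn_rot turn_swap turn_rot. Qed.

Lemma turnxx a p q : turn a p p q = 0.
Proof. by rewrite /turn; coordinates. Qed.

(** No point of [s] lies in the hull of the others. *)
Definition convex_position (s : seq vec) :=
  forall p, p \in s -> ~ hull [set x | x \in s /\ x != p] p.

(** Every point of [b] lies strictly to the left of each side of the closed
    polygon [b] that does not contain it. *)
Definition convex_cycle a (b : seq vec) :=
  forall p r, p \in b -> r \in b -> r != p -> r != next b p ->
  0 < turn a p (next b p) r.

Section CyclicOrder.

Variables (a w : vec) (h : R) (s : seq vec).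
Hypothesis h_gt0 : 0 < h.
Hypothesis level : forall p, p \in s -> dot w (p - a) = h.
Hypothesis s_cvx : convex_position s.

(** For points of a plane off [a], the signed areas of the triangles on a
    fourth point add up. *)
Lemma turn_sum p q r x : p \in s -> q \in s -> r \in s -> x \in s ->
  turn a p q r = turn a q r x + turn a r p x + turn a p q x.
Proof.
move=> sp sq sr sx; apply: (mulIf (lt0r_neq0 h_gt0)).
rewrite -{1}(level sx) /turn (cramer w) !level // -!mulrDl; congr (_ * h).
by rewrite -(triple_rot (x - a) (q - a)) -(triple_rot (p - a) (x - a))
  -(triple_rot (x - a) (r - a)).
Qed.

(** A point on the inner side of the three sides of a positively oriented
    triangle would belong to it. *)
Lemma notin_triangle p q r x : p \in s -> q \in s -> r \in s -> x \in s ->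
  p != x -> q != x -> r != x ->
  0 <= turn a q r x -> 0 <= turn a r p x -> 0 <= turn a p q x ->
  turn a p q r <= 0.
Proof.
move=> sp sq sr sx px qx rx t1 t2 t3; rewrite leNgt; apply/negP => t0.
apply: (s_cvx sx).
suff : hull [set p; q; r] x.
  by apply: hullS => y [[->|->]|->].
move: (t0); rewrite (turn_sum sp sq sr sx) => t0'.
apply: (@hull3 _ _ _ _ _ _ _ t1 t2 t3) => //; rewrite -(turn_sum sp sq sr sx).
have := cramer_vec (p - a) (q - a) (r - a) (x - a).
rewrite -(triple_rot (x - a) (q - a)) -(triple_rot (p - a) (x - a))
  -(triple_rot (x - a) (r - a)) => E.
have -> : turn a p q r *: x = turn a p q r *: (x - a) + turn a p q r *: a.
  by rewrite scalerBr subrK.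
rewrite {1}/turn E (turn_sum sp sq sr sx) /turn.
apply/rowP => i; rewrite !mxE; ring.
Qed.

(** Three points in convex position are not collinear: one of them would lie
    between the other two. *)
Lemma turn_neq0 p q r : p \in s -> q \in s -> r \in s ->
  p != q -> q != r -> p != r -> turn a p q r != 0.
Proof.
move=> sp sq sr pq qr pr; apply/eqP => t0.
set e := q - p; set f := r - p; set n := cross e f.
(* The cross product n is a multiple of w, with a factor that vanishes with
   the determinant. *)
have we : dot w e = 0.
  by rewrite -(subrr h) -{1}(level sq) -(level sp) -dotBr opprB addrA subrK.
have wf : dot w f = 0.
  by rewrite -(subrr h) -{1}(level sr) -(level sp) -dotBr opprB addrA subrK.
have efp : triple e f (p - a) = 0.
  by rewrite -[RHS]t0 /turn /e /f; coordinates.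
have nw : dot n w = 0.
  apply: (mulIf (lt0r_neq0 h_gt0)); rewrite mul0r -(level sp) /n dot_crossl.
  by have := cramer w e f (p - a) w; rewrite we wf efp !mulr0 !add0r mul0r => <-.
have w0 : w != 0.
  apply/eqP => w0; have := level sp; rewrite w0 dot0l => h0.
  by move: h_gt0; rewrite -h0 ltxx.
have n0 : n = 0.
  apply/eqP; rewrite -dotvv_eq0; apply/eqP.
  apply: (mulIf (lt0r_neq0 (dotvv_gt0 w0))); rewrite mul0r.
  have := cramer w e f n w; rewrite we wf (dotC w n) nw.
  by move=> E; rewrite {1}/n dot_crossl E; ring.
have e0 : e != 0 by rewrite subr_eq0 eq_sym.
have ee := dotvv_gt0 e0.
set t := dot e f / dot e e.
have fE : f = t *: e.
  apply: (scalerI (lt0r_neq0 ee)).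
  rewrite scalerA /t mulrCA divff ?gt_eqF // mulr1.
  apply/eqP; rewrite -subr_eq0 (dotC e f) -cross_crossl.
  by rewrite (_ : cross e f = 0) // cross0l.
have rE : r = p + t *: (q - p) by rewrite -/e -fE /f addrC subrK.
(* The middle point is p, r or q according to the position of t with respect
   to 0 and 1. *)
have [t_lt0|t_ge0] := ltP t 0.
  apply: (s_cvx sp); suff : hull [set q; r; r] p.
    by apply: hullS => y [[->|->]|->]; rewrite /= ?sq ?sr eq_sym.
  apply: (@hull3 _ _ _ _ (- t) 1 0); rewrite ?oppr_ge0 ?(ltW t_lt0) //; first by lra.
  by rewrite [in RHS]rE; apply/rowP => i; rewrite !mxE; ring.
have [t_gt1|t_le1] := ltP 1 t.
  apply: (s_cvx sq); suff : hull [set r; p; p] q.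
    by apply: hullS => y [[->|->]|->]; rewrite /= ?sp ?sr // eq_sym.
  apply: (@hull3 _ _ _ _ 1 (t - 1) 0); rewrite ?subr_ge0 ?(ltW t_gt1) //; first by lra.
  by rewrite [in RHS]rE; apply/rowP => i; rewrite !mxE; ring.
apply: (s_cvx sr); suff : hull [set q; p; p] r.
  by apply: hullS => y [[->|->]|->].
apply: (@hull3 _ _ _ _ t (1 - t) 0); rewrite ?subr_ge0 //; first by lra.
by rewrite [in LHS]rE; apply/rowP => i; rewrite !mxE; ring.
Qed.

End CyclicOrder.

(** Points of a plane in convex position, sorted by angle around the first one,
    form a convex cycle. *)
Lemma convex_cycle_exists a w (h : R) (s : seq vec) : 0 < h ->
  (forall p, p \in s -> dot w (p - a) = h) -> convex_position s ->
  uniq s -> exists2 b, perm_eq b s & convex_cycle a b.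
Proof.
case: s => [|o s] h_gt0 level s_cvx; first by exists [::].
set S := o :: s => Su.
have So : o \in S by rewrite mem_head.
have sS p : p \in s -> p \in S by rewrite inE orbC => ->.
have so p : p \in s -> p != o.
  by move=> sp; apply: contraTneq Su => po; rewrite /S /= -po sp.
pose le p q := 0 <= turn a o p q.
have tot : total le.
  by move=> p q; rewrite /le (turn_swapr a o p q) oppr_ge0 le_total.
have trs : {in mem s & &, transitive le}.
  move=> q p r sq sp sr; rewrite /le => pq qr; rewrite leNgt; apply/negP => pr.
  (* Otherwise o lies in the triangle p q r. *)
  have := notin_triangle h_gt0 level s_cvx (sS _ sp) (sS _ sq) (sS _ sr) So
    (so _ sp) (so _ sq) (so _ sr).
  rewrite (turn_sum h_gt0 level (sS _ sp) (sS _ sq) (sS _ sr) So).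
  rewrite (turn_rot a o r p) (turn_swapr a o p r) (turn_rot a o q r) (turn_rot a o p q).
  by move=> /(_ qr); lra.
set t := sort le s.
have ts : perm_eq t s by rewrite perm_sort.
have tu : uniq (o :: t) by rewrite (perm_uniq (_ : perm_eq _ S)) // perm_cons.
have mem_t : t =i s by apply: perm_mem.
have pw : pairwise le t.
  by rewrite -(sorted_pairwise_in trs) ?sort_sorted // all_sort; apply/allP.
set b := o :: t.
have bS : perm_eq b S by rewrite perm_cons.
have mem_b : b =i S by apply: perm_mem.
have bsz i : (i < size b)%N -> nth o b i \in S.
  by move=> ib; rewrite -mem_b mem_nth.
have neq k1 k2 : (k1 < size b)%N -> (k2 < size b)%N -> (k1 != k2)%N ->
    nth o b k1 != nth o b k2 by move=> *; rewrite nth_uniq.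
have turn0 j k : (0 < j)%N -> (j < k)%N -> (k < size b)%N ->
    0 < turn a o (nth o b j) (nth o b k).
  move=> j0 jk kb; have jb := ltn_trans jk kb; have k0 := ltn_trans j0 jk.
  rewrite lt_neqAle eq_sym (turn_neq0 h_gt0 level s_cvx) ?bsz //=.
  - case: j k j0 jk jb kb k0 => [//|j] [//|k] _ jk jb kb _.
    by move/pairwiseP: pw => /(_ o); apply.
  - by rewrite (neq 0 j) // ltn_eqF.
  - by rewrite neq // ltn_eqF.
  - by rewrite (neq 0 k) // ltn_eqF.
have turn3 i j k : (i < j)%N -> (j < k)%N -> (k < size b)%N ->
    0 < turn a (nth o b i) (nth o b j) (nth o b k).
  move=> ij jk kb; have jb := ltn_trans jk kb; have ib := ltn_trans ij jb.
  case: i => [|i] in ij ib *; first exact: turn0.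
  have ik := ltn_trans ij jk.
  rewrite lt_neqAle eq_sym (turn_neq0 h_gt0 level s_cvx) ?bsz ?neq ?ltn_eqF //=.
  (* Otherwise b_j lies in the triangle o b_i b_k. *)
  rewrite leNgt; apply/negP => tlt.
  have t_oij := turn0 i.+1 j isT ij jb.
  have t_ojk := turn0 j k (leq_ltn_trans (leq0n _) ij) jk kb.
  have t_oik := turn0 i.+1 k isT ik kb.
  have oj : o != nth o b j by rewrite (neq 0 j) // ltn_eqF // (leq_ltn_trans _ ij).
  have := notin_triangle h_gt0 level s_cvx So (bsz _ ib) (bsz _ kb) (bsz _ jb)
    oj (neq _ _ ib jb (negbT (ltn_eqF ij))) (neq _ _ kb jb (negbT (gtn_eqF jk))).
  rewrite (turn_swapr _ _ (nth o b j)) oppr_ge0 (ltW tlt).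
  rewrite -(turn_rot a _ o (nth o b j)) (ltW t_ojk) (ltW t_oij).
  by move=> /(_ isT isT isT); rewrite leNgt t_oik.
exists b => // p r pb rb.
have ip : (index p b < size b)%N by rewrite index_mem.
have ir : (index r b < size b)%N by rewrite index_mem.
have nxt : next b p = nth o t (index p b) by rewrite next_nth pb.
have [pE rE] := (nth_index o pb, nth_index o rb).
move: nxt ip ir pE rE; set i := index p b; set k := index r b => nxt ip ir pE rE rp.
have ik : k != i by apply: contra_neq rp => kE; rewrite -rE -pE kE.
have [it|it] := ltnP i (size t); last first.
  rewrite nxt nth_default // => ro.
  have iE : i = size t by apply/eqP; rewrite eqn_leq it -ltnS ip.
  rewrite -turn_rot -pE -rE; apply: turn0 => //.
    by rewrite lt0n; apply: contra_neq ro => k0; rewrite -rE k0.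
  by rewrite iE ltn_neqAle -{1}iE ik -ltnS.
rewrite nxt (_ : nth o t i = nth o b i.+1) // => rn.
have kn : k != i.+1 by apply: contra_neq rn => kE; rewrite -rE kE.
rewrite -pE -rE; case: (ltnP k i) => [ki|].
  by rewrite turn_rot; apply: (turn3 k i i.+1).
rewrite leq_eqVlt eq_sym (negbTE ik) leq_eqVlt eq_sym (negbTE kn) /= => ki.
exact: (turn3 i i.+1 k).
Qed.

(** * Collinear sets and rescaled normals *)

Lemma not_collinear_three A : ~ collinear A ->
  exists x y z, [/\ A x, A y & A z] /\ [/\ x != y, y != z & x != z].
Proof.
move=> nA; apply: contrapT => n3; apply: nA.
have [[x Ax]|nx] := pselect (exists x, A x); last first.
  by exists 0, 0 => x Ax; case: nx; exists x.
have [[y Ay xy]|ny] := pselect (exists2 y, A y & x != y); last first.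
  exists x, 0 => y Ay; exists 0; rewrite scaler0 addr0; apply/eqP.
  by rewrite eq_sym; apply: contrapT => /negP xy; apply: ny; exists y.
exists x, (y - x) => z Az.
have [<-|xz] := eqVneq x z; first by exists 0; rewrite scale0r addr0.
have [<-|yz] := eqVneq y z; first by exists 1; rewrite scale1r addrC subrK.
by case: n3; exists x, y, z.
Qed.

Lemma collinear_hull A : collinear A -> collinear (hull A).
Proof.
move=> [p [d Ad]]; exists p, d.
suff : hull A `<=` [set x | exists t : R, x = p + t *: d] by [].
by apply: hull_sub; [exact: convex_line|exact: Ad].
Qed.

Lemma collinear_segment p q : collinear (segment p q).
Proof.
apply: collinear_hull; exists p, (q - p) => x [->|->].
  by exists 0; rewrite scale0r addr0.
by exists 1; rewrite scale1r addrC subrK.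
Qed.

Lemma hull1 x : hull [set x] = [set x].
Proof.
apply/seteqP; split; last exact: sub_hull.
apply: hull_sub => //; apply/convex_setP => y z t _ /= -> ->.
by rewrite -scalerDl addrC subrK scale1r.
Qed.

Lemma face_scale A u t : 0 < t -> face A (t *: u) = face A u.
Proof.
move=> t0; apply/seteqP; split=> x [Ax xmax]; split=> // y /xmax;
  by rewrite !dotZl ler_pM2l.
Qed.

Lemma anticlockwise_tour_scale A u t s : 0 < t ->
  anticlockwise_tour A u s -> anticlockwise_tour A (t *: u) s.
Proof.
move=> t0 [s_uniq s_edges s_all]; split=> //; last by rewrite face_scale.
move=> p /s_edges[pq e sub left]; split=> //; rewrite face_scale //.
move=> x /left le0.
have -> : triple (t *: u) (next s p - p) (x - p) = t * triple u (next s p - p) (x - p).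
  by coordinates.
by rewrite mulr_ge0 // ltW.
Qed.

(** * Edges and facets of a pyramid *)

(** Here [b] is the base in cyclic order, in the plane [dot w (x - a) = h]. *)
Section Faces.

Variables (a w : vec) (h : R) (b : seq vec).
Hypothesis h_gt0 : 0 < h.
Hypothesis level : forall p, p \in b -> dot w (p - a) = h.
Hypothesis b_cvx : convex_position b.
Hypothesis b_uniq : uniq b.
Hypothesis b_size : (2 < size b)%N.
Hypothesis b_cycle : convex_cycle a b.

(** The apex and the vertices of the base. *)
Definition vertices : set vec := a |` [set` b].
Let V := vertices.
Let P := hull V.

Lemma apex_notin : a \notin b.
Proof.
by apply/negP => /level; rewrite subrr dot0r => h0; move: h_gt0; rewrite -h0 ltxx.
Qed.

Lemma apex_neq p : p \in b -> a != p.
Proof. by move=> pb; apply: contraTneq pb => <-; rewrite apex_notin. Qed.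

Lemma third_vertex p q : exists r, [/\ r \in b, r != p & r != q].
Proof.
have [/hasP[r rb /norP[rp rq]]|/hasPn no] :=
  boolP (has [pred r | ~~ ((r == p) || (r == q))] b).
  by exists r.
have := uniq_leq_size b_uniq (s2 := [:: p; q]).
rewrite leqNgt b_size => H; suff : false by [].
by apply: H => r /no; rewrite /= negbK !inE.
Qed.

Lemma next_neq p : p \in b -> next b p != p.
Proof.
move=> pb; apply/eqP => np; have [r [rb rp _]] := third_vertex p p.
by have := b_cycle pb rb rp; rewrite np turnxx ltxx => /(_ rp).
Qed.

Lemma next2_neq p : p \in b -> next b (next b p) != p.
Proof.
move=> pb; have qb : next b p \in b by rewrite mem_next.
apply/eqP => np; have [r [rb rp rq]] := third_vertex p (next b p).
have := b_cycle pb rb rp rq; have := b_cycle qb rb rq.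
by rewrite np => /(_ rp); rewrite turn_swap; lra.
Qed.

Lemma turn_next_ge0 p r : p \in b -> r \in b -> 0 <= turn a p (next b p) r.
Proof.
move=> pb rb; have [->|rp] := eqVneq r p.
  by rewrite -turn_rot -turn_rot turnxx.
have [->|rq] := eqVneq r (next b p); first by rewrite -turn_rot turnxx.
exact/ltW/b_cycle.
Qed.

(** [face_hull] with functionals measured from the apex. *)
Lemma face_max u m : (forall x, V x -> dot u (x - a) <= m) ->
  (exists2 x, V x & dot u (x - a) = m) ->
  face P u = hull [set x | V x /\ dot u (x - a) = m].
Proof.
move=> Vm [x Vx xm]; rewrite (@face_hull V u (m + dot u a)).
- congr hull; apply/seteqP; split=> y [Vy ym]; split=> //; move: ym;
    rewrite dotBr; lra.
- by move=> y /Vm; rewrite dotBr; lra.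
- by exists x => //; rewrite -xm dotBr subrK.
Qed.

Lemma face_maxP u : exists m,
  [/\ forall x, V x -> dot u (x - a) <= m,
      exists2 x, V x & dot u (x - a) = m &
      face P u = hull [set x | V x /\ dot u (x - a) = m]].
Proof.
have [x xV xmax] := seq_max (fun x => dot u (x - a)) a b.
have VE y : V y <-> y \in a :: b.
  by rewrite inE; split=> [[->|yb]|/predU1P[->|yb]];
    rewrite ?eqxx // ?[y \in b]yb ?orbT //; [left|right].
exists (dot u (x - a)); split; first by move=> y /VE/xmax.
  by exists x => //; apply/VE.
by apply: face_max; [move=> y /VE/xmax|exists x => //; apply/VE].
Qed.

Lemma face_vertex_le u x y : face P u x -> V y -> dot u (y - a) <= dot u (x - a).
Proof.
by move=> [_ xmax] Vy; rewrite !dotBr lerD2r; apply: xmax; exact: sub_hull.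
Qed.

(** An outward normal of the triangle on the base edge from [p] to its
    successor. *)
Definition normal p := cross (next b p - a) (p - a).

Lemma dot_normal p x : dot (normal p) (x - a) = - turn a p (next b p) x.
Proof. by rewrite /normal dot_crossl -turn_swap. Qed.

Lemma dot_normal_le0 p x : p \in b -> V x -> dot (normal p) (x - a) <= 0.
Proof.
move=> pb [->|xb]; first by rewrite subrr dot0r.
by rewrite dot_normal oppr_le0 turn_next_ge0.
Qed.

Lemma dot_normal_eq0 p x : p \in b -> V x -> dot (normal p) (x - a) = 0 <->
  [\/ x = a, x = p | x = next b p].
Proof.
move=> pb Vx; split; last first.
  case=> ->; first by rewrite subrr dot0r.
    by rewrite dot_normal -turn_rot -turn_rot turnxx oppr0.
  by rewrite dot_normal -turn_rot turnxx oppr0.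
case: Vx => [->|xb]; first by move=> _; exact: Or31.
rewrite dot_normal => /eqP; rewrite oppr_eq0 => /eqP t0.
have [->|xp] := eqVneq x p; first exact: Or32.
have [->|xq] := eqVneq x (next b p); first exact: Or33.
by have := b_cycle pb xb xp xq; rewrite t0 ltxx.
Qed.

Lemma dot_base_le x : V x -> dot w (x - a) <= h.
Proof. by case=> [->|/level -> //]; rewrite subrr dot0r ltW. Qed.

Lemma dot_base_eq x : V x -> dot w (x - a) = h <-> x \in b.
Proof.
case=> [->|xb]; last by split=> // _; exact: level.
split; last exact: level.
by rewrite subrr dot0r => h0; move: h_gt0; rewrite -h0 ltxx.
Qed.

(** A functional that is maximal at exactly two vertices exposes an edge, which
    contains no other vertex. *)
Lemma edge_expose u m x y : x != y -> V x -> V y ->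
  (forall z, V z -> dot u (z - a) <= m) ->
  (forall z, V z -> dot u (z - a) = m <-> z = x \/ z = y) ->
  edge P (segment x y) /\ (forall z, V z -> segment x y z -> z = x \/ z = y).
Proof.
move=> xy Vx Vy um uE.
have xm : dot u (x - a) = m by apply/(uE x Vx); left.
have fE : face P u = segment x y.
  rewrite (face_max um); last by exists x.
  congr hull; apply/seteqP; split=> z; first by case=> Vz /(uE z Vz).
  by case=> ->; split=> //; apply/(uE y Vy); right.
split; last first.
  move=> z Vz; rewrite -fE => /face_vertex_le/(_ Vx); rewrite xm => zm.
  by apply/(uE z Vz)/eqP; rewrite eq_le um.
exists u, x, y; split=> //; apply/eqP => u0.
have [r [rb rx ry]] := third_vertex x y.
have Vr : V r by right.
have [] : r = x \/ r = y by apply/(uE r Vr); rewrite -xm u0 !dot0l.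
  by move/eqP; rewrite (negbTE rx).
by move/eqP; rewrite (negbTE ry).
Qed.

(** An edge is exposed by the sum of the normals of its two facets. *)
Lemma edge_lateral p : p \in b ->
  edge P (segment a p) /\ (forall z, V z -> segment a p z -> z = a \/ z = p).
Proof.
move=> pb; have p'b : prev b p \in b by rewrite mem_prev.
have np' : next b (prev b p) = p by rewrite next_prev.
apply: (@edge_expose (normal p + normal (prev b p)) 0); [exact: apex_neq|by left|by right| |].
  by move=> z Vz; rewrite dotDl -[0]addr0 lerD ?dot_normal_le0.
move=> z Vz; rewrite dotDl; split; last first.
  case=> zE; first by rewrite zE subrr !dot0r addr0.
  rewrite ((dot_normal_eq0 pb Vz).2 (Or32 _ _ zE)).
  by rewrite ((dot_normal_eq0 p'b Vz).2 (Or33 _ _ _)) ?addr0 ?np'.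
move=> /eqP; rewrite naddr_eq0 ?dot_normal_le0 // => /andP[/eqP z1 /eqP z2].
case/(dot_normal_eq0 pb Vz): z1 => [|| zq]; [by left|by right|].
case/(dot_normal_eq0 p'b Vz): z2 => [|zp'|]; [by left| |by rewrite np'; right].
have := next2_neq p'b; rewrite np' -zq zp' eqxx //.
Qed.

Lemma edge_base p : p \in b -> edge P (segment p (next b p)) /\
  (forall z, V z -> segment p (next b p) z -> z = p \/ z = next b p).
Proof.
move=> pb; have qb : next b p \in b by rewrite mem_next.
apply: (@edge_expose (normal p + w) h);
  [by rewrite eq_sym next_neq|by right|by right| |].
  by move=> z Vz; rewrite dotDl -[h]add0r lerD ?dot_normal_le0 ?dot_base_le.
move=> z Vz; rewrite dotDl; split; last first.
  have zb : z = p \/ z = next b p -> z \in b by case=> ->.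
  move=> zE; rewrite (level (zb zE)) ((dot_normal_eq0 pb Vz).2 _) ?add0r //.
  by case: zE; [exact: Or32|exact: Or33].
have n0 := dot_normal_le0 pb Vz; have wh := dot_base_le Vz => nwh.
have zb : z \in b by apply/(dot_base_eq Vz); lra.
have : dot (normal p) (z - a) = 0 by lra.
case/(dot_normal_eq0 pb Vz) => [za|->|->]; [|by left|by right].
by move: zb; rewrite za (negbTE apex_notin).
Qed.

Lemma vertices_not_collinear x y z : V x -> V y -> V z ->
  x != y -> y != z -> x != z -> ~ collinear [set x; y; z].
Proof.
move=> Vx Vy Vz xy yz xz [p [d line]].
have [t xE] : exists t : R, x = p + t *: d by apply: line; left; left.
have [t' yE] : exists t : R, y = p + t *: d by apply: line; left; right.
have [t'' zE] : exists t : R, z = p + t *: d by apply: line; right.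
have apexF u v s s' s'' : u \in b -> v \in b -> u != v ->
    a = p + s *: d -> u = p + s' *: d -> v = p + s'' *: d -> False.
  move=> ub vb uv aE uE vE; have [r [rb ru rv]] := third_vertex u v.
  have := turn_neq0 h_gt0 level b_cvx ub vb rb uv; rewrite eq_sym rv eq_sym ru.
  move=> /(_ isT isT)/eqP; apply.
  by rewrite /turn uE vE aE; coordinates.
case: Vx Vy Vz => [xa|xb] [ya|yb] [za|zb].
- by move: xy; rewrite xa ya eqxx.
- by move: xy; rewrite xa ya eqxx.
- by move: xz; rewrite xa za eqxx.
- by apply: (apexF y z) yz _ yE zE => //; rewrite -xa; exact: xE.
- by move: yz; rewrite ya za eqxx.
- by apply: (apexF x z) xz _ xE zE => //; rewrite -ya; exact: yE.
- by apply: (apexF x y) xy _ xE yE => //; rewrite -za; exact: zE.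
have := turn_neq0 h_gt0 level b_cvx xb yb zb xy yz xz => /eqP; apply.
by rewrite /turn xE yE zE; coordinates.
Qed.

(** If a functional vanishes at two base vertices and is positive at the others,
    these all lie on one side of the line through the two, which are therefore
    consecutive. *)
Lemma adjacent g x y : x \in b -> y \in b -> x != y ->
  dot g (x - a) = 0 -> dot g (y - a) = 0 ->
  (forall z, z \in b -> z != x -> z != y -> 0 < dot g (z - a)) ->
  y = next b x \/ x = next b y.
Proof.
move=> xb yb xy gx gy g_gt0.
have [|ynx] := eqVneq y (next b x); first by left.
have [|xny] := eqVneq x (next b y); first by right.
have rb : next b x \in b by rewrite mem_next.
have sb : next b y \in b by rewrite mem_next.
have := cramer g (x - a) (y - a) (next b x - a) (next b y - a).
rewrite gx gy !mulr0 !add0r => E; exfalso.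
have yx : y != x by rewrite eq_sym.
have ynx' : next b x != y by rewrite eq_sym.
have xny' : next b y != x by rewrite eq_sym.
have gr := g_gt0 _ rb (next_neq xb) ynx'.
have gs := g_gt0 _ sb xny' (next_neq yb).
have := b_cycle xb yb yx ynx; rewrite turn_swapr oppr_gt0 => tr.
have := b_cycle yb xb xy xny; rewrite turn_swapr oppr_gt0 turn_swap oppr_lt0 => ts.
move: E tr ts; rewrite -/(turn _ _ _ _) -/(turn _ _ _ _) => E tr ts.
have : turn a x y (next b x) * dot g (next b y - a) < 0 by rewrite nmulr_rlt0.
by rewrite E pmulr_llt0 // ltNge ltW.
Qed.

(** The only edges are the lateral ones and the sides of the base. *)
Lemma edgeP E : edge P E -> (exists2 p, p \in b & E = segment a p) \/
  (exists2 p, p \in b & E = segment p (next b p)).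
Proof.
move=> [u [p0 [q0 [u0 pq0 Eseg Eface]]]].
have [m [um [x Vx xm] fE]] := face_maxP u.
move: fE; set T := [set x | _] => fE; have ET : E = hull T by rewrite Eface.
have Tx : T x by [].
have [y [Vy ym] xy] : exists2 y, T y & x != y.
  apply: contrapT => ny; have Tsub : T `<=` [set x].
    move=> y Ty; apply/eqP; rewrite eq_sym; apply: contrapT => /negP xy.
    by apply: ny; exists y.
  have Ex : E `<=` [set x] by rewrite ET -(hull1 x); apply: hullS.
  have /Ex/= p0x : E p0 by rewrite Eseg; apply: sub_hull; left.
  have /Ex/= q0x : E q0 by rewrite Eseg; apply: sub_hull; right.
  by move: pq0; rewrite p0x q0x eqxx.
have Txy z : T z -> z = x \/ z = y.
  move=> [Vz zm]; have [|zx] := eqVneq z x; first by left.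
  have [|zy] := eqVneq z y; first by right.
  have /(vertices_not_collinear Vx Vy Vz xy) : y != z by rewrite eq_sym.
  rewrite eq_sym zx => /(_ isT); case.
  have [p [d line]] := collinear_segment p0 q0; exists p, d => t txyz.
  apply: line; rewrite -/(segment p0 q0) -Eseg ET; apply: sub_hull.
  by case: txyz => [[->|->]|->].
have Exy : E = segment x y.
  rewrite ET; congr hull; apply/seteqP; split=> z; first exact: Txy.
  by case=> ->.
case: (Vx) => [xa|xb].
  left; exists y; last by rewrite Exy xa.
  by case: Vy => // ya; move: xy; rewrite xa ya eqxx.
case: (Vy) => [ya|yb].
  by left; exists x => //; rewrite Exy ya segmentC.
(* On the base plane this functional is h times the deficit m - dot u. *)
right; have := @adjacent (m *: w - h *: u) x y xb yb xy.
have gE z : z \in b -> dot (m *: w - h *: u) (z - a) = h * (m - dot u (z - a)).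
  by move=> zb; rewrite dotBl !dotZl level //; ring.
rewrite !gE // xm ym !subrr mulr0 => /(_ erefl erefl).
case=> [z zb zx zy|yx|yx].
- have Vz : V z by right.
  rewrite gE // mulr_gt0 // subr_gt0 lt_neqAle um // andbT.
  apply/eqP => zm; have [] : z = x \/ z = y by apply: Txy.
    by move/eqP; rewrite (negbTE zx).
  by move/eqP; rewrite (negbTE zy).
- by exists x => //; rewrite Exy yx.
- by exists y => //; rewrite Exy segmentC yx.
Qed.

Lemma normal_neq0 p : p \in b -> normal p != 0.
Proof.
move=> pb; have [r [rb rp rq]] := third_vertex p (next b p).
apply/eqP => n0; have := dot_normal p r; rewrite n0 dot0l => /esym/eqP.
by rewrite oppr_eq0 gt_eqF // b_cycle.
Qed.

(** A functional that vanishes on the plane of a side is determined up to a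
    factor, whose sign is read off at one further vertex. *)
Lemma normal_multiple u p r : p \in b -> r \in b -> r != p -> r != next b p ->
  dot u (p - a) = 0 -> dot u (next b p - a) = 0 -> dot u (r - a) < 0 ->
  exists2 t, 0 < t & u = t *: normal p.
Proof.
move=> pb rb rp rq up uq ur; have nn := dotvv_gt0 (normal_neq0 pb).
set n := normal p in nn *; set t := dot n u / dot n n.
have utn : u = t *: n.
  apply/eqP; rewrite -subr_eq0; apply/eqP.
  apply: (@eq0_of_triple_neq0 _ (next b p - a) (p - a) n).
  - by rewrite -dot_crossl gt_eqF.
  - rewrite dotBl dotZl uq (iffRL (dot_normal_eq0 pb _)) ?mulr0 ?subrr //.
      by right; rewrite /= mem_next.
    exact: Or33.
  - rewrite dotBl dotZl up (iffRL (dot_normal_eq0 pb _)) ?mulr0 ?subrr //.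
      by right.
    exact: Or32.
  - by rewrite dotBl dotZl /t mulfVK ?gt_eqF // (dotC n u) subrr.
exists t => //; move: ur; rewrite utn dotZl dot_normal mulrN oppr_lt0.
by rewrite pmulr_lgt0 // b_cycle.
Qed.

(** The only facets are the base, with outward normal [w], and the sides. *)
Lemma facet_normalP u : facet_normal P u ->
  (exists2 t, 0 < t & u = t *: w) \/
  (exists2 p, p \in b & exists2 t, 0 < t & u = t *: normal p).
Proof.
move=> [u0 ncol]; have [m [um _ fE]] := face_maxP u.
move: fE; set T := [set x | _] => fE.
have [x [y [z [[Tx Ty Tz] [xy yz xz]]]]] : exists x y z,
    [/\ T x, T y & T z] /\ [/\ x != y, y != z & x != z].
  by apply: not_collinear_three => /collinear_hull; rewrite -fE.
have [[Va am]|aT] := pselect (T a); last first.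
  (* The functional is constant on three base vertices in general position. *)
  left; have Tb t : T t -> t \in b.
    by move=> Tt; case: (Tt) => -[ta|//] _; case: aT; rewrite -ta.
  have g0 t : T t -> dot (m *: w - h *: u) (t - a) = 0.
    move=> Tt; case: (Tt) => _ tm; rewrite dotBl !dotZl tm (level (Tb _ Tt)); ring.
  have /eqP : m *: w - h *: u = 0.
    by apply: (eq0_of_triple_neq0 _ (g0 _ Tx) (g0 _ Ty) (g0 _ Tz));
      apply: (turn_neq0 h_gt0 level b_cvx) => //; apply: Tb.
  rewrite subr_eq0 => /eqP mwhu; exists (m / h).
    rewrite divr_gt0 // lt_neqAle; have Va : V a by left.
    have := um a Va; rewrite subrr dot0r => ->; rewrite andbT.
    by apply/eqP => m0; case: aT; split=> //; rewrite subrr dot0r.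
  by rewrite mulrC -scalerA mwhu scalerA mulVf ?scale1r // gt_eqF.
(* The apex is maximal, so that m = 0 and two base vertices lie on the facet. *)
right; move: am; rewrite subrr dot0r => m0.
have [p [q [[pb Tp] [qb Tq] pq]]] : exists p q,
    [/\ p \in b /\ T p, q \in b /\ T q & p != q].
  have Tb t : T t -> t = a \/ t \in b by case.
  case: (Tb _ Tx) => [xa|xb]; last first.
    case: (Tb _ Ty) => [ya|yb]; last by exists x, y.
    case: (Tb _ Tz) => [za|zb]; last by exists x, z.
    by move: yz; rewrite ya za eqxx.
  case: (Tb _ Ty) => [ya|yb]; first by move: xy; rewrite xa ya eqxx.
  case: (Tb _ Tz) => [za|zb]; first by move: xz; rewrite xa za eqxx.
  by exists y, z.
have up : dot u (p - a) = 0 by rewrite m0; case: Tp.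
have uq : dot u (q - a) = 0 by rewrite m0; case: Tq.
have u_lt0 t : t \in b -> t != p -> t != q -> dot u (t - a) < 0.
  move=> tb tp tq; rewrite lt_neqAle m0 um ?andbT; last by right.
  apply/eqP => um0; move/eqP: u0; apply.
  apply: (@eq0_of_triple_neq0 _ (p - a) (q - a) (t - a)) => //; last by rewrite um0.
  by apply: (turn_neq0 h_gt0 level b_cvx) => //; rewrite eq_sym.
have [r [rb rp rq]] := third_vertex p q.
have := @adjacent (- u) p q pb qb pq; rewrite !dotNl up uq oppr0 => /(_ erefl erefl).
case=> [t tb tp tq|qE|pE].
- by rewrite dotNl oppr_gt0 u_lt0.
- by exists p => //; apply: (@normal_multiple u p r); rewrite -?qE ?u_lt0.
- by exists q => //; apply: (@normal_multiple u q r); rewrite -?pE ?u_lt0.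
Qed.

(** * Anticlockwise tours of the facets *)

(** The orientation condition of [anticlockwise_edge] needs checking at the
    vertices of the face only. *)
Lemma anticlockwise_edgeI u (T : set vec) p q : face P u = hull T ->
  T p -> T q -> p != q -> edge P (segment p q) ->
  (forall x, T x -> 0 <= triple u (q - p) (x - p)) ->
  anticlockwise_edge P u p q.
Proof.
move=> fE Tp Tq pq epq left; split=> //; rewrite fE.
  by apply: hullS => x [->|->].
have tE x : triple u (q - p) (x - p) = - dot (cross u (q - p)) p - dot (- cross u (q - p)) x.
  by rewrite dotNl; coordinates.
suff sub : hull T `<=` [set x | dot (- cross u (q - p)) x <= - dot (cross u (q - p)) p].
  by move=> x /sub /=; rewrite tE subr_ge0.
apply: hull_sub; first exact: convex_halfspace.
by move=> x /left; rewrite tE subr_ge0.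
Qed.

Lemma tour_base : anticlockwise_tour P w b.
Proof.
have [x0 [x0b _ _]] := third_vertex a a.
have fE := face_max dot_base_le (ex_intro2 _ _ x0 (or_intror x0b) (level x0b)).
split=> //.
- move=> p pb; have qb : next b p \in b by rewrite mem_next.
  apply: (anticlockwise_edgeI fE).
  + by split; [right|exact: level].
  + by split; [right|exact: level].
  + by rewrite eq_sym next_neq.
  + exact: (edge_base pb).1.
  + move=> x [Vx /(dot_base_eq Vx) xb].
    set e := next b p - p; set f := x - p.
    have we : dot w e = 0.
      by rewrite -(subrr h) -{1}(level qb) -(level pb) -dotBr opprB addrA subrK.
    have wf : dot w f = 0.
      by rewrite -(subrr h) -{1}(level xb) -(level pb) -dotBr opprB addrA subrK.
    have := cramer w e f (p - a) w.
    rewrite we wf !mulr0 !add0r (level pb) (triple_rot w e f).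
    have -> : triple e f (p - a) = turn a p (next b p) x by rewrite /turn /e /f; coordinates.
    have := turn_next_ge0 pb xb; have := dotvv_ge0 w => ww tt E.
    by rewrite -(pmulr_lge0 _ h_gt0) -E mulr_ge0.
- move=> E /edgeP[[p pb ->]|//] sub.
  have /sub fa : segment a p a by apply: sub_hull; left.
  have Vp : V p by right.
  by have := face_vertex_le fa Vp; rewrite subrr dot0r level // leNgt h_gt0.
Qed.

Lemma tour_side p : p \in b ->
  anticlockwise_tour P (normal p) [:: next b p; p; a].
Proof.
move=> pb; set q := next b p; have qb : q \in b by rewrite mem_next.
have qp : q != p by rewrite next_neq.
have [aq ap] := (apex_neq qb, apex_neq pb).
have [Va Vp Vq] : [/\ V a, V p & V q] by split; [left|right|right].
have fE := face_max (fun x => dot_normal_le0 pb (x := x))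
  (ex_intro2 _ _ a Va (iffRL (dot_normal_eq0 pb Va) (Or31 _ _ erefl))).
move: fE; set T := [set x | _] => fE.
have Ta : T a by split=> //; apply/dot_normal_eq0 => //; exact: Or31.
have Tp : T p by split=> //; apply/dot_normal_eq0 => //; exact: Or32.
have Tq : T q by split=> //; apply/dot_normal_eq0 => //; exact: Or33.
have TP x : T x -> [\/ x = a, x = p | x = q].
  by case=> Vx /(dot_normal_eq0 pb Vx).
have nn := dotvv_ge0 (normal p).
have [nq np na] : [/\ next [:: q; p; a] q = p, next [:: q; p; a] p = a
    & next [:: q; p; a] a = q].
  by apply: next3.
have [lat_p lat_q base_p] := And3 (edge_lateral pb) (edge_lateral qb) (edge_base pb).
split.
- by rewrite /= !inE negb_or qp eq_sym aq eq_sym ap.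
- move=> x; rewrite !inE => /or3P[]/eqP->; rewrite ?nq ?np ?na.
  + apply: (anticlockwise_edgeI fE) => //; first by rewrite segmentC; case: base_p.
    move=> x' /TP[]->.
    * by rewrite (_ : triple _ _ _ = dot (normal p) (normal p)) // /normal -/q; coordinates.
    * by rewrite (_ : triple _ _ _ = 0) // /normal -/q; coordinates.
    * by rewrite (_ : triple _ _ _ = 0) // /normal -/q; coordinates.
  + apply: (anticlockwise_edgeI fE) => //; first by rewrite eq_sym.
      by rewrite segmentC; case: lat_p.
    move=> x' /TP[]->.
    * by rewrite (_ : triple _ _ _ = 0) // /normal -/q; coordinates.
    * by rewrite (_ : triple _ _ _ = 0) // /normal -/q; coordinates.
    * by rewrite (_ : triple _ _ _ = dot (normal p) (normal p)) // /normal -/q; coordinates.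
  + apply: (anticlockwise_edgeI fE) => //; first by case: lat_q.
    move=> x' /TP[]->.
    * by rewrite (_ : triple _ _ _ = 0) // /normal -/q; coordinates.
    * by rewrite (_ : triple _ _ _ = dot (normal p) (normal p)) // /normal -/q; coordinates.
    * by rewrite (_ : triple _ _ _ = 0) // /normal -/q; coordinates.
- have inT x : V x -> face P (normal p) x -> [\/ x = a, x = p | x = q].
    move=> Vx /face_vertex_le/(_ Va); rewrite subrr dot0r => n0.
    by apply: TP; split=> //; apply/eqP; rewrite eq_le n0 dot_normal_le0.
  move=> E /edgeP[] [r rb ->] sub.
    have /sub/inT : segment a r r by apply: sub_hull; right.
    case=> [|ra|->|->]; first by right.
    + by move: rb; rewrite ra (negbTE apex_notin).
    + by exists p; rewrite ?np ?inE ?eqxx ?orbT // segmentC.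
    + by exists a; rewrite ?na ?inE ?eqxx ?orbT.
  have sb : next b r \in b by rewrite mem_next.
  have /sub/inT : segment r (next b r) r by apply: sub_hull; left.
  case=> [|ra|->|rq]; first by right.
  + by move: rb; rewrite ra (negbTE apex_notin).
  + by exists q; rewrite ?nq ?inE ?eqxx // segmentC.
  have /sub/inT : segment r (next b r) (next b r) by apply: sub_hull; right.
  case=> [|sa|sp|sq]; first by right.
  + by move: sb; rewrite sa (negbTE apex_notin).
  + by exists q; rewrite ?nq ?inE ?eqxx // sp rq.
  + by have := next_neq rb; rewrite sq rq eqxx.
Qed.

(** * The labelling *)

(** The labelling [a b_i |-> 2i + 1] and [b_i b_(i+1) |-> 2i].  The vertices of
    an edge are recovered from the set of its points: no other vertex lies on
    it.  On a set that is not an edge the value is irrelevant. *)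
Definition label (E : set vec) : int :=
  (if `[< E a >] then (find (fun x => `[< E x >]) b).*2.+1
   else (find (fun x => `[< E x /\ E (next b x) >]) b).*2)%:Z.

Lemma find_index (f : pred vec) p : p \in b ->
  (forall x, x \in b -> f x = (x == p)) -> find f b = index p b.
Proof. by move=> pb fE; apply: eq_in_find => x /fE. Qed.

Lemma label_lateral p : p \in b -> label (segment a p) = (index p b).*2.+1.
Proof.
move=> pb; rewrite /label asboolT; last by apply: sub_hull; left.
rewrite (find_index pb) // => x xb; apply/asboolP/eqP => [|->]; last first.
  by apply: sub_hull; right.
have Vx : V x by right.
case/(edge_lateral pb).2 => // xa; by move: xb; rewrite xa (negbTE apex_notin).
Qed.

Lemma label_base p : p \in b -> label (segment p (next b p)) = (index p b).*2.
Proof.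
move=> pb; have qb : next b p \in b by rewrite mem_next.
have Vb x : x \in b -> V x by right.
rewrite /label asboolF; last first.
  case/(edge_base pb).2; first by left.
    by move=> ap; have := apex_neq pb; rewrite -ap eqxx.
  by move=> aq; have := apex_neq qb; rewrite -aq eqxx.
rewrite (find_index pb) // => x xb; apply/asboolP/eqP => [|->]; last first.
  by split; apply: sub_hull; [left|right].
have nxb : next b x \in b by rewrite mem_next.
case=> /(edge_base pb).2[|//|xq]; first exact: Vb.
move=> /(edge_base pb).2[|nxp|nxq]; first exact: Vb.
  by have := next2_neq pb; rewrite -xq nxp eqxx.
by have := next_neq xb; rewrite nxq xq eqxx.
Qed.

Lemma anticlockwise_tour_rot u s k :
  anticlockwise_tour P u s -> anticlockwise_tour P u (rot k s).
Proof.
move=> [s_uniq s_edges s_all]; split; first by rewrite rot_uniq.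
  by move=> p; rewrite mem_rot next_rot //; exact: s_edges.
move=> E EP /s_all[] // p ps ->.
by exists p; rewrite ?mem_rot ?next_rot.
Qed.

Lemma label_coherent : coherent P label.
Proof.
move=> u /facet_normalP[[t t0 ->]|[p pb [t t0 ->]]].
  exists b; first exact/anticlockwise_tour_scale/tour_base.
  rewrite (eq_in_map _ (fun p => (index p b).*2%:Z) _).1; last exact: label_base.
  apply/(sortedP 0) => i; rewrite size_map => ib.
  rewrite !(nth_map 0) ?(ltnW ib) // !index_uniq ?(ltnW ib) //.
  by rewrite ltz_nat ltn_double.
have qb : next b p \in b by rewrite mem_next.
set q := next b p in qb *.
have qp : q != p by rewrite next_neq.
have [aq ap] := (apex_neq qb, apex_neq pb).
have tour := anticlockwise_tour_scale t0 (tour_side pb).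
have [nq np na] : [/\ next [:: q; p; a] q = p, next [:: q; p; a] p = a
    & next [:: q; p; a] a = q].
  by apply: next3.
have lq : label (segment q p) = (index p b).*2 by rewrite segmentC label_base.
have lp : label (segment p a) = (index p b).*2.+1 by rewrite segmentC label_lateral.
have la : label (segment a q) = (index q b).*2.+1 by rewrite label_lateral.
have pn : (index p b < size b)%N by rewrite index_mem.
have qE : q = nth (head a b) (behead b) (index p b).
  by rewrite /q next_nth pb; case: (b) pb.
(* The tour of a side starts at its base edge, except for the last side, where
   it starts at the apex. *)
have [ip|ip] := ltnP (index p b).+1 (size b).
  have iq : index q b = (index p b).+1.
    by rewrite qE nth_behead index_uniq.
  exists [:: q; p; a]; first exact: tour.
  rewrite /map nq np na lq lp la iq /=.
  by rewrite !ltz_nat doubleS !ltnS leqnn leqnSn.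
have iq : index q b = 0%N.
  rewrite qE nth_default ?size_behead; last by rewrite -ltnS prednK // (ltn_trans _ b_size).
  by case: (b) pb => //= x s _; rewrite eqxx.
have ip2 : (0 < index p b)%N by rewrite -ltnS (leq_trans (ltnW b_size)).
exists (rot 2 [:: q; p; a]); first exact: anticlockwise_tour_rot.
rewrite (eq_map (g := fun x => label (segment x (next [:: q; p; a] x)))); last first.
  move=> x; rewrite next_rot //; by case: tour.
rewrite (_ : rot 2 _ = [:: a; q; p]) // /map nq np na lq lp la iq /=.
by case: (index p b) ip2 => // i _; rewrite !ltz_nat doubleS leqnn.
Qed.

End Faces.

(** * Pyramids *)

Lemma coplanarW A B : A `<=` B -> coplanar B -> coplanar A.
Proof. by move=> AB [u [c [u0 Bc]]]; exists u, c; split=> // x /AB/Bc. Qed.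

Lemma dot_hull u c A : (forall x, A x -> dot u x = c) ->
  forall x, hull A x -> dot u x = c.
Proof.
move=> Ac; suff sub : hull A `<=` [set x | dot u x = c] by move=> x /sub.
apply: hull_sub; last exact: Ac.
by apply/convex_setP => x y t _ /= xc yc; rewrite dotDr !dotZr xc yc; ring.
Qed.

(** A normal of the plane of the base, directed away from the apex. *)
Lemma base_normal a A : coplanar A -> ~ coplanar (a |` hull A) ->
  exists w h, 0 < h /\ forall p, A p -> dot w (p - a) = h.
Proof.
move=> [u [c [u0 Ac]]] ncop; have [uac|uac|uac] := ltgtP (dot u a) c.
- exists u, (c - dot u a); rewrite subr_gt0; split=> // p /Ac.
  by rewrite dotBr => ->.
- exists (- u), (dot u a - c); rewrite subr_gt0; split=> // p /Ac.
  by rewrite dotBr !dotNl => ->; ring.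
- case: ncop; exists u, c; split=> // x [->//|].
  exact: dot_hull.
Qed.

Lemma pyramid_coherently_labellable n (P : set vec) : (3 <= n)%N ->
  pyramid n P -> coherently_labellable P.
Proof.
move=> n3 [B [a [[v [v_cop v_cvx ->]] ncop ->]]].
have [w [h [h_gt0 level]]] := base_normal v_cop ncop.
have v_inj : injective v.
  move=> i j vij; apply: contrapT => ij; apply: (v_cvx i).
  by apply: sub_hull; exists j; rewrite //= eq_sym; apply/eqP.
pose s := codom v.
have sP p : p \in s <-> range v p.
  by split=> [/codomP[i ->]|[i _ <-]]; [exists i|exact: codom_f].
have s_cvx : convex_position s.
  move=> p /codomP[i ->] vi; apply: (v_cvx i); apply: hullS vi.
  move=> x [/codomP[j ->] ji]; exists j => //=.
  by apply: contra_neq ji => ->.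
have s_uniq : uniq s by apply/injectiveP.
have s_level p : p \in s -> dot w (p - a) = h by move/sP/level.
have [b bs b_cycle] := convex_cycle_exists h_gt0 s_level s_cvx s_uniq.
have mem_b : b =i s by exact: perm_mem.
have VE : vertices a b = a |` range v.
  by congr (_ |` _); apply/seteqP; split=> p /=; rewrite mem_b => /sP.
rewrite hullU1 -VE; split; last first.
  exists (label a b); apply: (@label_coherent _ w h) => //.
  - by move=> p; rewrite mem_b; exact: s_level.
  - move=> p; rewrite mem_b => /s_cvx np hp; apply: np; apply: hullS hp.
    by move=> x /=; rewrite mem_b.
  - by rewrite (perm_uniq bs).
  - by rewrite (perm_size bs) size_codom card_ord.
split.
  apply: contra_not ncop; apply: coplanarW; rewrite VE -hullU1; exact: sub_hull.
exists (vertices a b); split=> //; rewrite /vertices finite_setU; split=> //.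
Qed.

End Pyramids.

Theorem mainTheorem2 (R : realType) (n : nat) (hn : (3 <= n)%N)
    (P : set 'rV[R]_3) (hP : pyramid n P) :
  coherently_labellable P.
Proof. exact: pyramid_coherently_labellable hn hP. Qed.
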